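(* Suppose $-2 < \beta \leq 0$. Then there exist a positive integer $N$ and a quasisymmetric map $\Phi_\beta: \mathbb{R}^2 \rightarrow \mathbb{R}^N$ (both spaces with the Euclidean metric) whose Jacobian is comparable to $|x|^\beta$ almost everywhere; that is, $\Phi_\beta$ is differentiable at almost every point of $\mathbb{R}^2$ and there is a constant $C \geq 1$ such that $$\frac{1}{C}|x|^\beta \leq J_{\Phi_\beta}(x,y) \leq C|x|^\beta$$ for almost every $(x,y) \in \mathbb{R}^2$ (with respect to Lebesgue measure).
   Context: Jacobian: for a map $f: \mathbb{R}^2 \rightarrow \mathbb{R}^N$ differentiable at a point $z$, $J_f(z) = \sqrt{\det(Df(z)^{T}Df(z))}$, the factor by which $f$ infinitesimally multiplies two-dimensional volume at $z$. Quasisymmetry: let $(X,d_X)$ and $(Y,d_Y)$ be metric spaces and $f: X \rightarrow Y$ an injective map. For an increasing homeomorphism $\eta: (0,\infty) \rightarrow (0,\infty)$, $f$ is $\eta$-quasisymmetric if for all $z_1,z_2,z_3 \in X$ with $z_2 \neq z_1$ and $z_3 \neq z_1$, $$\frac{d_Y(f(z_3),f(z_1))}{d_Y(f(z_2),f(z_1))} \leq \eta\left(\frac{d_X(z_3,z_1)}{d_X(z_2,z_1)}\right).$$ $f$ is quasisymmetric if it is $\eta$-quasisymmetric for some such $\eta$. *)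

(* Defs.v *)
From HB Require Import structures.
From mathcomp Require Import all_boot all_order all_algebra.
From mathcomp Require Import all_classical all_reals all_analysis.
From mathcomp Require Import ring lra.
Set Implicit Arguments.
Unset Strict Implicit.
Unset Printing Implicit Defensive.
Import Order.TTheory GRing.Theory Num.Theory.
Import numFieldNormedType.Exports.
Local Open Scope classical_set_scope.
Local Open Scope ring_scope.

Definition euclidean_dist (R : realType) (n : nat) (u v : 'rV[R]_n) : R :=
  Num.sqrt (\sum_(i < n) (u 0 i - v 0 i) ^+ 2).

Lemma cauchy_schwarz_sum (R : realType) (n : nat) (a b : 'I_n -> R) :
  (\sum_i a i * b i) ^+ 2 <= (\sum_i a i ^+ 2) * (\sum_i b i ^+ 2).
Proof.
have : 0 <= \sum_i \sum_j (a i * b j - a j * b i) ^+ 2.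
  by apply: sumr_ge0 => i _; apply: sumr_ge0 => j _; exact: sqr_ge0.
have -> : \sum_i \sum_j (a i * b j - a j * b i) ^+ 2 =
    ((\sum_i a i ^+ 2) * (\sum_i b i ^+ 2)) *+ 2 -
    (\sum_i a i * b i) ^+ 2 *+ 2.
  have H (c d : 'I_n -> R) :
      (\sum_i c i) * (\sum_i d i) = \sum_i \sum_j c i * d j.
    by rewrite mulr_suml; apply: eq_bigr => i _; rewrite mulr_sumr.
  rewrite mulr2n {2}[(\sum_i a i ^+ 2) * _]mulrC expr2 !H -sumrMnl -!big_split.
  rewrite -sumrB.
  apply: eq_bigr => i _; rewrite -sumrMnl -!big_split /= -sumrB.
  by apply: eq_bigr => j _; ring.
by rewrite -mulrnBl pmulrn_lge0 // subr_ge0.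
Qed.

Lemma euclidean_distxx (R : realType) (n : nat) (u : 'rV[R]_n) : euclidean_dist u u = 0.
Proof.
by rewrite /euclidean_dist big1 ?sqrtr0 // => i _; rewrite subrr expr0n.
Qed.

Lemma euclidean_dist_positivity (R : realType) (n : nat) (u v : 'rV[R]_n) :
  euclidean_dist u v = 0 -> u = v.
Proof.
move=> /eqP; rewrite sqrtr_eq0 => le0.
have /eqP : \sum_(i < n) (u 0 i - v 0 i) ^+ 2 = 0.
  by apply/eqP; rewrite eq_le le0 sumr_ge0 // => i _; exact: sqr_ge0.
rewrite psumr_eq0 => [/allP h|i _]; last exact: sqr_ge0.
apply/rowP => i; apply/eqP; rewrite -subr_eq0 -sqrf_eq0.
by apply: h; rewrite mem_index_enum.
Qed.

Lemma euclidean_dist_sym (R : realType) (n : nat) (u v : 'rV[R]_n) :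
  euclidean_dist u v = euclidean_dist v u.
Proof.
by congr Num.sqrt; apply: eq_bigr => i _; rewrite -sqrrN opprB.
Qed.

Lemma euclidean_dist_triangle (R : realType) (n : nat) (v u w : 'rV[R]_n) :
  euclidean_dist u w <= euclidean_dist u v + euclidean_dist v w.
Proof.
rewrite /euclidean_dist.
set S := \sum_i (u 0 i - v 0 i) ^+ 2; set T := \sum_i (v 0 i - w 0 i) ^+ 2.
have S0 : 0 <= S by apply: sumr_ge0 => i _; exact: sqr_ge0.
have T0 : 0 <= T by apply: sumr_ge0 => i _; exact: sqr_ge0.
have ST0 : 0 <= Num.sqrt S + Num.sqrt T by rewrite addr_ge0 ?sqrtr_ge0.
rewrite -(ger0_norm ST0) -sqrtr_sqr ler_wsqrtr // sqrrD !sqr_sqrtr //.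
pose P := \sum_i (u 0 i - v 0 i) * (v 0 i - w 0 i).
have -> : \sum_(i < n) (u 0 i - w 0 i) ^+ 2 = S + P *+ 2 + T.
  rewrite -sumrMnl -!big_split /=; apply: eq_bigr => i _; ring.
rewrite lerD2r lerD2l lerMn2r /=.
rewrite (le_trans (ler_norm P)) // -sqrtr_sqr -sqrtrM // ler_wsqrtr //.
exact: cauchy_schwarz_sum.
Qed.

(* The norm that the library puts on 'rV[R]_n is the sup norm; this alias
   carries the Euclidean metric instead. *)
Definition euclidean (R : realType) (n : nat) : Type := 'rV[R]_n.

HB.instance Definition _ (R : realType) (n : nat) :=
  Choice.copy (euclidean R n) 'rV[R]_n.

HB.instance Definition _ (R : realType) (n : nat) :=
  @isMetric.Build R (euclidean R n) (@euclidean_dist R n) (@euclidean_distxx R n)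
    (@euclidean_dist_positivity R n) (@euclidean_dist_sym R n) (@euclidean_dist_triangle R n).

(* Only the values of [eta] and [theta] on (0, +oo) matter. *)
Definition increasing_homeo_pos (R : realType) (eta : R -> R) : Prop :=
  let P := `]0, +oo[ : interval R in
  {in P &, {homo eta : s t / s < t}} /\
  exists theta : R -> R,
    [/\ {homo eta : t / t \in P} /\ {homo theta : t / t \in P},
        {in P, cancel eta theta}, {in P, cancel theta eta},
        {within [set` P], continuous eta} &
        {within [set` P], continuous theta}].

Definition eta_quasisymmetric (R : realType) (X Y : metricType R)
    (eta : R -> R) (f : X -> Y) : Prop :=
  forall z1 z2 z3 : X, z2 <> z1 -> z3 <> z1 ->
    mdist (f z3) (f z1) / mdist (f z2) (f z1) <=
    eta (mdist z3 z1 / mdist z2 z1).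

Definition quasisymmetric (R : realType) (X Y : metricType R)
    (f : X -> Y) : Prop :=
  injective f /\
  exists eta : R -> R, increasing_homeo_pos eta /\ eta_quasisymmetric eta f.

(* Vectors are rows, so ['J f z] is the transpose of the usual matrix of
   Df(z): the product below is Df(z)^T Df(z). *)
Definition jacobian_factor (R : realType) (N : nat)
    (f : 'rV[R]_2 -> 'rV[R]_N) (z : 'rV[R]_2) : R :=
  Num.sqrt (\det ('J f z *m ('J f z)^T)).

Definition plane_point (R : realType) (p : R * R) : 'rV[R]_2 :=
  \row_(i < 2) (if i == 0 then p.1 else p.2).

(* The library has no measure on 'rV[R]_2: planar Lebesgue measure is the
   product measure on R * R, transported by [plane_point]. *)
Definition ae_plane (R : realType) (Q : 'rV[R]_2 -> Prop) : Prop :=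
  {ae ((@lebesgue_measure R) \x (@lebesgue_measure R))%E,
    forall p : R * R, Q (plane_point p)}.

(* Main.v *)
From HB Require Import structures.
Require Import Defs.
From mathcomp Require Import all_boot all_order all_algebra.
From mathcomp Require Import all_classical all_reals all_analysis.
From mathcomp Require Import ring lra.
Import Order.TTheory GRing.Theory Num.Theory.
Import numFieldNormedType.Exports.
Local Open Scope classical_set_scope.
Local Open Scope ring_scope.

(** Write [s = 1 + beta / 2], so [0 < s <= 1].  It suffices to embed the plane
    so that the distance between the images of [z = (x, y)] and [w] is
    comparable to [d (|x| + d)^(s - 1)], where [d] is the l1 distance from [z]
    to [w]: such a map is quasisymmetric with [eta t = M max(t, t^s)], and where
    it is differentiable its differential stretches every direction by about
    [|x|^(s - 1)], so its Jacobian is about [|x|^(2(s - 1)) = |x|^beta].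

    For [s = 1] the identity works.  For [s < 1] use an Assouad-type lacunary
    sum.  The components of
    [f(x, y) = (cos y, sin y, x) / (1 + x^2)] are Lipschitz, satisfy
    [|f z - f w| <= 6 d / (|x| + d)], and one of them separates [z] and [w] by at
    least [d / 8] when [|x| + d <= 1/2].  For [L = 2^K] put
    [H z = sum over n in Z of L^(- n s) (f (L^n z) - f 0)], so that
    [H (L z) = L^s H z].  For large [K] all terms with [n <> 0] together are
    negligible when [|x| + d] is about [1/4], and scaling reduces every pair of
    points to that situation for one of the maps [z |-> H (2^j z)], [j < K]. *)

(** * Elementary estimates for cosine, sine and the weight [1 / (1 + x^2)] *)

Section WaveProfile.
Context {R : realType}.
Implicit Types (x y t : R) (z w : 'rV[R]_2).

Lemma cos_lipschitz x y : `|cos x - cos y| <= `|x - y|.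
Proof.
wlog le_yx : x y / y <= x => [H|].
  by case: (leP y x) => [/H//|/ltW /H]; rewrite distrC (distrC y).
have [//||c _ ->] := @MVT_segment R cos (fun t => - sin t) y x.
  exact/continuous_subspaceT/continuous_cos.
by rewrite normrM normrN ler_piMl// sin_max.
Qed.

Lemma sin_lipschitz x y : `|sin x - sin y| <= `|x - y|.
Proof.
wlog le_yx : x y / y <= x => [H|].
  by case: (leP y x) => [/H//|/ltW /H]; rewrite distrC (distrC y).
have [//||c _ ->] := @MVT_segment R sin cos y x.
  exact/continuous_subspaceT/continuous_sin.
by rewrite normrM ler_piMl// cos_max.
Qed.

(** For [t >= 0], which suffices as sine is odd, the mean value theorem gives [sin t = t * cos c]
    with [0 <= c <= t], and [cos c >= 1 - c >= 1/2] because cosine is 1-Lipschitz. *)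
Lemma sin_ge_half t : `|t| <= 2^-1 -> `|t| / 2 <= `|sin t|.
Proof.
wlog t0 : t / 0 <= t => [H|].
  case: (leP 0 t) => [/H//|/ltW t0]; move: (H (- t)).
  by rewrite sinN !normrN oppr_ge0; apply.
rewrite ger0_norm// => t2.
have [//||c] := @MVT_segment R sin cos 0 t.
  exact/continuous_subspaceT/continuous_sin.
rewrite in_itv/= sin0 !subr0 => /andP[c0 ct] ->.
have := cos_lipschitz c 0; rewrite cos0 subr0 (ger0_norm c0) ler_norml => /andP[cc _].
rewrite normrM (ger0_norm t0) mulrC ler_wpM2r// (le_trans _ (ler_norm _))//.
lra.
Qed.

Definition lorentz x : R := (1 + x ^+ 2)^-1.

Lemma lorentz_den_gt0 x : 0 < 1 + x ^+ 2.
Proof. by rewrite ltr_pwDl// sqr_ge0. Qed.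

Lemma lorentz_gt0 x : 0 < lorentz x.
Proof. by rewrite invr_gt0 lorentz_den_gt0. Qed.

Lemma lorentz_le1 x : lorentz x <= 1.
Proof. by rewrite invf_le1 ?lorentz_den_gt0// lerDl sqr_ge0. Qed.

Lemma lorentz_norm_le x : `|x| * lorentz x <= 2^-1.
Proof.
rewrite ler_pdivrMr ?lorentz_den_gt0// -real_normK ?num_real//.
have := sqr_ge0 (`|x| - 1); lra.
Qed.

Lemma lorentz_sqr_le x : `|x| ^+ 2 * lorentz x <= 1.
Proof. by rewrite ler_pdivrMr ?lorentz_den_gt0// real_normK ?num_real// mul1r lerDr. Qed.

Lemma lorentzB x y :
  lorentz x - lorentz y = (y - x) * (x + y) * (lorentz x * lorentz y).
Proof.
have := gt_eqF (lorentz_den_gt0 x); have := gt_eqF (lorentz_den_gt0 y).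
rewrite /lorentz => /negbT hy /negbT hx; field; apply/andP; split; assumption.
Qed.

Lemma norm_lorentzB x y :
  `|lorentz x - lorentz y| <=
    `|x - y| * ((`|x| + `|y|) * (lorentz x * lorentz y)).
Proof.
rewrite lorentzB !normrM distrC !(gtr0_norm (lorentz_gt0 _)) -mulrA.
by rewrite ler_wpM2l// ler_wpM2r ?ler_normD// mulr_ge0// ltW// lorentz_gt0.
Qed.

Lemma lorentz_lipschitz x y : `|lorentz x - lorentz y| <= `|x - y|.
Proof.
apply: le_trans (norm_lorentzB x y) _; rewrite ler_piMr//.
have := lorentz_norm_le x; have := lorentz_norm_le y.
have := lorentz_gt0 x; have := lorentz_gt0 y.
have := lorentz_le1 x; have := lorentz_le1 y.
have := normr_ge0 x; have := normr_ge0 y.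
set a := `|x|; set b := `|y|; set p := lorentz x; set q := lorentz y.
move=> b0 a0 q1 p1 q0 p0 bq ap.
have : a * p * q <= 2^-1 by rewrite (le_trans _ ap)// ler_piMr// mulr_ge0// ltW.
have : b * q * p <= 2^-1 by rewrite (le_trans _ bq)// ler_piMr// mulr_ge0// ltW.
nra.
Qed.

(** What must be bounded is [|x| (|x| + |y|) lorentz x lorentz y]. The square term is at most 1; the
    hypothesis turns the mixed term into at most [2 |y|^2 lorentz x lorentz y <= 2]. *)
Lemma lorentz_decay x y : `|x| <= 2 * `|y| ->
  `|x| * `|lorentz x - lorentz y| <= 3 * `|x - y|.
Proof.
move=> xy; apply: le_trans (ler_wpM2l (normr_ge0 _) (norm_lorentzB x y)) _.
have := lorentz_sqr_le x; have := lorentz_sqr_le y.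
have := lorentz_gt0 x; have := lorentz_gt0 y.
have := lorentz_le1 x; have := lorentz_le1 y.
have := normr_ge0 x; have := normr_ge0 y; have := normr_ge0 (x - y).
move: xy; set a := `|x|; set b := `|y|; set p := lorentz x; set q := lorentz y.
move=> ab d0 b0 a0 q1 p1 q0 p0 bq ap.
rewrite mulrCA mulrC ler_wpM2r//.
have h1 : a ^+ 2 * p * q <= 1 by rewrite (le_trans _ ap)// ler_piMr// mulr_ge0 ?sqr_ge0// ltW.
have h2 : b ^+ 2 * q * p <= 1 by rewrite (le_trans _ bq)// ler_piMr// mulr_ge0 ?sqr_ge0// ltW.
have h3 : a * b * (p * q) <= 2 * b * b * (p * q).
  by rewrite ler_wpM2r ?ler_wpM2r// mulr_ge0// ltW.
lra.
Qed.

(** The exact factorisation serves both directions: it yields the upper estimates, and for small [x]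
    and [y] the factor [1 - x * y] stays away from 0, which makes the third profile component
    separate points. *)
Lemma xlorentzB x y : x * lorentz x - y * lorentz y =
  (x - y) * ((1 - x * y) * (lorentz x * lorentz y)).
Proof.
have := gt_eqF (lorentz_den_gt0 x); have := gt_eqF (lorentz_den_gt0 y).
rewrite /lorentz => /negbT hy /negbT hx; field; apply/andP; split; assumption.
Qed.

Lemma norm_xlorentzB x y : `|x * lorentz x - y * lorentz y| <=
  `|x - y| * ((1 + `|x| * `|y|) * (lorentz x * lorentz y)).
Proof.
rewrite xlorentzB !normrM !(gtr0_norm (lorentz_gt0 _)).
rewrite ler_wpM2l// ler_wpM2r//; first by rewrite mulr_ge0// ltW// lorentz_gt0.
by rewrite (le_trans (ler_normB _ _))// normr1 normrM.
Qed.

Lemma xlorentz_lipschitz x y : `|x * lorentz x - y * lorentz y| <= `|x - y|.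
Proof.
apply: le_trans (norm_xlorentzB x y) _; rewrite ler_piMr//.
rewrite mulrA ler_pdivrMr ?lorentz_den_gt0// ler_pdivrMr ?lorentz_den_gt0//.
rewrite mul1r -(real_normK (num_real x)) -(real_normK (num_real y)).
have := normr_ge0 x; have := normr_ge0 y; set a := `|x|; set b := `|y| => b0 a0.
have := sqr_ge0 (a - b); have : 0 <= (a * b) ^+ 2 by exact: sqr_ge0.
nra.
Qed.

Lemma xlorentz_decay x y :
  `|x| * `|x * lorentz x - y * lorentz y| <= 2 * `|x - y|.
Proof.
apply: le_trans (ler_wpM2l (normr_ge0 _) (norm_xlorentzB x y)) _.
rewrite mulrCA mulrC ler_wpM2r//.
have := lorentz_sqr_le x; have := lorentz_norm_le y; have := lorentz_norm_le x.
have := lorentz_gt0 x; have := lorentz_gt0 y.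
have := lorentz_le1 x; have := lorentz_le1 y.
have := normr_ge0 x; have := normr_ge0 y.
set a := `|x|; set b := `|y|; set p := lorentz x; set q := lorentz y.
move=> b0 a0 q1 p1 q0 p0 ap bq a2p.
have h1 : (a * p) * q <= 2^-1 * 1 by rewrite ler_pM// ?mulr_ge0// ltW.
have h2 : (a ^+ 2 * p) * (b * q) <= 1 * 2^-1 by rewrite ler_pM// ?mulr_ge0 ?sqr_ge0// ltW.
lra.
Qed.

End WaveProfile.

(** * The three-component profile: Lipschitz, decay and separation estimates *)

Section Profile.
Context {R : realType}.
Implicit Types (z w : 'rV[R]_2).

Definition dist1 z w : R := `|z 0 0 - w 0 0| + `|z 0 1 - w 0 1|.

Lemma dist1_ge0 z w : 0 <= dist1 z w.
Proof. by rewrite addr_ge0. Qed.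

Lemma dist1_gt0 z w : z <> w -> 0 < dist1 z w.
Proof.
move=> zw; rewrite lt0r dist1_ge0 andbT; apply/eqP => /eqP.
rewrite paddr_eq0// !normr_eq0 !subr_eq0 => /andP[/eqP z0 /eqP z1]; apply: zw.
apply/rowP => -[[|[|//]] i2].
- by have -> : Ordinal i2 = 0 by exact: val_inj.
- by have -> : Ordinal i2 = 1 by exact: val_inj.
Qed.

(** Every index from 2 on denotes the third component, so the upper estimates hold for all [i]
    without a range condition. *)
Definition profile (i : nat) z : R :=
  match i with
  | 0 => lorentz (z 0 0) * cos (z 0 1)
  | 1 => lorentz (z 0 0) * sin (z 0 1)
  | _ => z 0 0 * lorentz (z 0 0)
  end.

Section Lorentz_oscillation.
Variable g : R -> R.
Hypothesis g_bounded : forall y, `|g y| <= 1.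
Hypothesis g_lipschitz : forall x y, `|g x - g y| <= `|x - y|.

(** The difference is split so that [|y - y'|] carries the weight at [x]: in the decay estimate the
    prefactor [|x|] then meets [lorentz x], and their product is bounded. *)
Lemma lorentz_mul_dist (x x' y y' : R) :
  `|lorentz x * g y - lorentz x' * g y'| <=
    `|lorentz x - lorentz x'| + lorentz x * `|y - y'|.
Proof.
have -> : lorentz x * g y - lorentz x' * g y' =
  (lorentz x - lorentz x') * g y' + lorentz x * (g y - g y') by ring.
apply: le_trans (ler_normD _ _) _; rewrite !normrM (gtr0_norm (lorentz_gt0 x)).
by rewrite lerD ?ler_piMr// ler_wpM2l// ltW// lorentz_gt0.
Qed.

Lemma lorentz_mul_lipschitz (x x' y y' : R) :
  `|lorentz x * g y - lorentz x' * g y'| <= `|x - x'| + `|y - y'|.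
Proof.
apply: le_trans (lorentz_mul_dist _ _ _ _) _.
by rewrite lerD ?lorentz_lipschitz// ler_piMl// lorentz_le1.
Qed.

Lemma lorentz_mul_decay (x x' y y' : R) : `|x| <= 2 * `|x'| ->
  `|x| * `|lorentz x * g y - lorentz x' * g y'| <= 3 * (`|x - x'| + `|y - y'|).
Proof.
move=> xx'; apply: le_trans (ler_wpM2l (normr_ge0 x) (lorentz_mul_dist _ _ _ _)) _.
rewrite mulrDr mulrDr lerD//; first exact: lorentz_decay.
rewrite mulrA ler_wpM2r// (le_trans (lorentz_norm_le x))//; lra.
Qed.

Lemma lorentz_mul_bounded (x y : R) : `|lorentz x * g y| <= 1.
Proof.
rewrite normrM (gtr0_norm (lorentz_gt0 x)) mulr_ile1// ?lorentz_le1//.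
by rewrite ltW// lorentz_gt0.
Qed.

End Lorentz_oscillation.

Lemma profile_lipschitz i z w : `|profile i z - profile i w| <= dist1 z w.
Proof.
case: i => [|[|i]] /=.
- exact: lorentz_mul_lipschitz _ (@cos_max R) cos_lipschitz _ _ _ _.
- exact: lorentz_mul_lipschitz _ (@sin_max R) sin_lipschitz _ _ _ _.
- by apply: le_trans (xlorentz_lipschitz _ _) _; rewrite lerDl.
Qed.

Lemma profile_bounded i z : `|profile i z| <= 1.
Proof.
case: i => [|[|i]] /=.
- exact: lorentz_mul_bounded _ (@cos_max R) _ _.
- exact: lorentz_mul_bounded _ (@sin_max R) _ _.
- rewrite normrM (gtr0_norm (lorentz_gt0 _)).
  by rewrite (le_trans (lorentz_norm_le _))//; lra.
Qed.

(** If [|x| <= 2 d], boundedness suffices: an oscillation of at most 2 times a reach of at most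
    [3 d]. Otherwise [w] has abscissa at least [|x| / 2] in size, and the decay estimates for the
    single components apply. *)
Lemma profile_decay i z w :
  `|profile i z - profile i w| * (`|z 0 0| + dist1 z w) <= 6 * dist1 z w.
Proof.
have d0 := dist1_ge0 z w; have p0 := normr_ge0 (profile i z - profile i w).
have [far|near] := leP `|z 0 0| (2 * dist1 z w).
  have p2 : `|profile i z - profile i w| <= 2.
    rewrite (le_trans (ler_normB _ _))//.
    by have := profile_bounded i z; have := profile_bounded i w; lra.
  have : `|z 0 0| + dist1 z w <= 3 * dist1 z w by lra.
  move=> /(ler_pM p0 _ p2) H; rewrite (le_trans (H _))//; last lra.
  by rewrite addr_ge0.
have zw : `|z 0 0| <= 2 * `|w 0 0|.
  have := lerB_dist (z 0 0) (w 0 0).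
  have : `|z 0 0 - w 0 0| <= dist1 z w by rewrite lerDl.
  by lra.
have : `|z 0 0| * `|profile i z - profile i w| <= 3 * dist1 z w.
  case: i {p0} => [|[|i]] /=.
  - exact: lorentz_mul_decay _ (@cos_max R) cos_lipschitz _ _ _ _ zw.
  - exact: lorentz_mul_decay _ (@sin_max R) sin_lipschitz _ _ _ _ zw.
  - apply: le_trans (xlorentz_decay _ _) _.
    have : `|z 0 0 - w 0 0| <= dist1 z w by rewrite lerDl.
    by lra.
have : `|profile i z - profile i w| * dist1 z w <=
    `|profile i z - profile i w| * `|z 0 0| by rewrite ler_wpM2l//; lra.
lra.
Qed.

(* The distance from [p e^(iy)] to the line spanned by [e^(iy')] is
   [|p sin (y - y')|]. *)
Lemma polar_dist_ge (p q y y' : R) :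
  (p * sin (y - y')) ^+ 2 <=
    (p * cos y - q * cos y') ^+ 2 + (p * sin y - q * sin y') ^+ 2.
Proof.
have e : (p * cos y - q * cos y') ^+ 2 + (p * sin y - q * sin y') ^+ 2 =
  p ^+ 2 * (cos y ^+ 2 + sin y ^+ 2) + q ^+ 2 * (cos y' ^+ 2 + sin y' ^+ 2)
  - 2 * p * q * cos (y - y') by rewrite cosB; ring.
rewrite {}e !cos2Dsin2 !mulr1 exprMn sin2cos2.
have := sqr_ge0 (q - p * cos (y - y')); lra.
Qed.

Lemma lorentz_ge_near0 (x : R) : `|x| <= 2^-1 -> 4 / 5 <= lorentz x.
Proof.
move=> x2; rewrite -[leRHS]div1r ler_pdivlMr ?lorentz_den_gt0//.
rewrite -(real_normK (num_real x)); have := normr_ge0 x; nra.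
Qed.

(** If the horizontal displacement dominates, the third component separates the points by
    [xlorentzB]. If the vertical one dominates, the first two components, read as polar coordinates
    with angle [y], separate them. *)
Lemma profile_lower z w : `|z 0 0| + dist1 z w <= 2^-1 ->
  exists2 i, (i < 3)%N & dist1 z w / 8 <= `|profile i z - profile i w|.
Proof.
rewrite /dist1 => S1.
have dx0 := normr_ge0 (z 0 0 - w 0 0); have dy0 := normr_ge0 (z 0 1 - w 0 1).
have z2 : `|z 0 0| <= 2^-1 by lra.
have w2 : `|w 0 0| <= 2^-1.
  by have := lerB_dist (w 0 0) (z 0 0); rewrite distrC; lra.
have p45 := lorentz_ge_near0 _ z2; have q45 := lorentz_ge_near0 _ w2.
have [dxy|dxy] := leP `|z 0 1 - w 0 1| `|z 0 0 - w 0 0|.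
  exists 2%N => //=; rewrite xlorentzB normrM.
  have h : 4^-1 <= `|(1 - z 0 0 * w 0 0) * (lorentz (z 0 0) * lorentz (w 0 0))|.
    rewrite !normrM !(gtr0_norm (lorentz_gt0 _)).
    have h1 : 3 / 4 <= `|1 - z 0 0 * w 0 0|.
      have := lerB_dist 1 (z 0 0 * w 0 0); rewrite normr1 normrM.
      have : `|z 0 0| * `|w 0 0| <= 2^-1 * 2^-1 by rewrite ler_pM.
      lra.
    have h2 : 4 / 5 * (4 / 5) <= lorentz (z 0 0) * lorentz (w 0 0).
      by rewrite ler_pM//; lra.
    have : 3 / 4 * (4 / 5 * (4 / 5)) <= `|1 - z 0 0 * w 0 0| *
        (lorentz (z 0 0) * lorentz (w 0 0)) by rewrite ler_pM//; lra.
    lra.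
  have := ler_wpM2l dx0 h; lra.
set t := `|z 0 1 - w 0 1| in S1 dy0 dxy *.
have h : (4 / 5 * (t / 2)) ^+ 2 <=
    (profile 0 z - profile 0 w) ^+ 2 + (profile 1 z - profile 1 w) ^+ 2.
  apply: le_trans (polar_dist_ge _ _ _ _).
  rewrite -[leRHS](real_normK (num_real _)) ler_sqr ?nnegrE//; last lra.
  rewrite normrM (gtr0_norm (lorentz_gt0 _)); apply: ler_pM; [lra|lra|exact: p45|].
  apply: sin_ge_half; rewrite -/t; have := normr_ge0 (z 0 0); lra.
have [h0|h0] := leP ((`|z 0 0 - w 0 0| + t) / 8) `|profile 0 z - profile 0 w|.
  by exists 0%N.
have [h1|h1] := leP ((`|z 0 0 - w 0 0| + t) / 8) `|profile 1 z - profile 1 w|.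
  by exists 1%N.
(* Both components would differ by at most [t / 4], so their squares would sum to at most [t^2 / 8],
   less than [(2 t / 5)^2]. *)
exfalso; move: h.
rewrite -(real_normK (num_real (profile 0 z - _))).
rewrite -(real_normK (num_real (profile 1 z - _))).
have := normr_ge0 (profile 0 z - profile 0 w).
have := normr_ge0 (profile 1 z - profile 1 w).
move: h0 h1; set a := `|profile 0 z - _|; set b := `|profile 1 z - _|.
move=> a8 b8 b0 a0.
have at4 : a <= t / 4 by lra.
have bt4 : b <= t / 4 by lra.
nra.
Qed.

Lemma differentiable_profile i z : differentiable (profile i) z.
Proof.
have dcoord j : differentiable (fun u : 'rV[R]_2 => u 0 j : R) z.
  exact: differentiable_coord.
have dl : differentiable (fun u : 'rV[R]_2 => lorentz (u 0 0)) z.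
  apply: differentiableV => //; last by rewrite gt_eqF// lorentz_den_gt0.
  have -> : (fun u : 'rV[R]_2 => 1 + u 0 0 ^+ 2) =
      cst 1 + (fun u : 'rV[R]_2 => u 0 0) * (fun u : 'rV[R]_2 => u 0 0).
    by apply/funext => u; rewrite expr2.
  by apply: differentiableD => //; exact: differentiableM.
case: i => [|[|i]] /=.
- apply: differentiableM => //; apply: differentiable_comp => //.
  exact/derivable1_diffP.
- apply: differentiableM => //; apply: differentiable_comp => //.
  exact/derivable1_diffP.
- exact: differentiableM.
Qed.

End Profile.

(** * Series dominated by a geometric series *)

Section GeometricSeries.
Context {R : realType}.

Lemma geometric_dominated_series (u : R^nat) (A k : R) : 0 <= k < 1 ->
    (forall n, `|u n| <= A * k ^+ n) ->
  cvgn (series u) /\ `|limn (series u)| <= A / (1 - k).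
Proof.
move=> /andP[k0 k1] uA.
have nk : `|k| < 1 by rewrite ger0_norm.
have cg : cvgn (series (geometric A k)) by exact: is_cvg_geometric_series.
have cn : cvgn [normed series u].
  apply: (@series_le_cvg _ _ (geometric A k)) => // n; first exact: normr_ge0.
  exact: le_trans (normr_ge0 _) (uA n).
split; first exact: normed_cvg.
apply: le_trans (lim_series_norm cn) _.
rewrite -(cvg_lim _ (@cvg_geometric_series _ A _ nk))//.
exact: lim_series_le.
Qed.

Lemma geometric_dominated_tail (u : R^nat) (A k : R) (M : nat) : 0 <= k < 1 ->
    (forall n, `|u n| <= A * k ^+ n) ->
  `|limn (series u) - series u M| <= A * k ^+ M / (1 - k).
Proof.
move=> k01 uA.
have [cu _] := geometric_dominated_series u _ _ k01 uA.
have vA n : `|u (n + M)%N| <= A * k ^+ M * k ^+ n.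
  by rewrite (le_trans (uA _))// exprD mulrAC mulrA.
have [_] := geometric_dominated_series (fun n => u (n + M)%N) _ _ k01 vA.
suff -> : limn (series (fun n => u (n + M)%N)) = limn (series u) - series u M by [].
apply/cvg_lim => //.
have -> : series (fun n => u (n + M)%N) = (fun n => series u (n + M)%N - series u M).
  apply/funext => n; rewrite series_addn addrAC subrr add0r.
  by rewrite -[X in \sum_(X <= _ < _) _]add0n big_addn addnK.
apply: cvgB; last exact: cvg_cst.
by rewrite cvg_shiftn.
Qed.

End GeometricSeries.

(** * Bounds on differentials and termwise differentiation of series *)

Section DifferentiableSeries.
Context {R : realType} {V : normedModType R}.

Lemma diff_norm_le (W : normedModType R) (f : V -> W) (z h : V) (b : R) :
    differentiable f z ->
    (\forall t \near 0^', `|t^-1 *: (f (t *: h + z) - f z)| <= b) ->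
  `|'d f z h| <= b.
Proof.
move=> df fb; rewrite -deriveE// /derive.
have cf : cvg ((fun t => t^-1 *: ((f \o shift z) (t *: h) - f z)) @ 0^').
  exact: diff_derivable.
rewrite -lim_norm//; apply: limr_le => //; exact: is_cvg_norm.
Qed.

Lemma diff_norm_ge (W : normedModType R) (f : V -> W) (z h : V) (a : R) :
    differentiable f z ->
    (\forall t \near 0^', a <= `|t^-1 *: (f (t *: h + z) - f z)|) ->
  a <= `|'d f z h|.
Proof.
move=> df fa; rewrite -deriveE// /derive.
have cf : cvg ((fun t => t^-1 *: ((f \o shift z) (t *: h) - f z)) @ 0^').
  exact: diff_derivable.
rewrite -lim_norm//; apply: limr_ge => //; exact: is_cvg_norm.
Qed.

Lemma diff_lipschitz (f : V -> R) (z h : V) (L : R) : differentiable f z ->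
    (forall w, `|f w - f z| <= L * `|w - z|) ->
  `|'d f z h| <= L * `|h|.
Proof.
move=> df fL; apply: diff_norm_le => //.
near=> t.
have t0 : t != 0 by near: t; exact: nbhs_dnbhs_neq.
rewrite normrZ normfV ler_pdivrMl ?normr_gt0// (le_trans (fL _))//.
by rewrite addrK normrZ mulrCA.
Unshelve. all: by end_near. Qed.

(** [differentiable] refers to the canonical differential; uniqueness identifies it with the
    candidate [D]. *)
Lemma differentiable_of_linear (f : V -> R) (z : V) (D : {linear V -> R}) :
    continuous D ->
    (forall e, 0 < e ->
      \forall h \near 0, `|f (h + z) - f z - D h| <= e * `|h|) ->
  differentiable f z.
Proof.
move=> Dc fD.
have e : f \o shift z = cst (f z) + D +o_ 0 id.
  apply/eqaddoP => _/posnumP[e]; near=> h.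
  rewrite /= fctE /= opprD addrA.
  by near: h; exact: fD.
by apply/diff_locallyP; rewrite (diff_unique Dc e).
Unshelve. all: by end_near. Qed.

(** The candidate differential is the sum of the differentials of the terms. In the remainder, any
    finite head is [o(h)], while the tail is at most a small multiple of [|h|], uniformly in [h], by
    the geometric Lipschitz constants at [z]. *)
Lemma differentiable_series (f : nat -> V -> R) (z : V) (A k : R) :
    0 <= k < 1 ->
    (forall n, differentiable (f n) z) ->
    (forall n w, `|f n w - f n z| <= A * k ^+ n * `|w - z|) ->
    cvgn (series (f ^~ z)) ->
  differentiable (fun w => limn (series (f ^~ w))) z.
Proof.
move=> k01 df fA cz.
have [k0 k1] := andP k01.
have DA h n : `|'d (f n) z h| <= A * `|h| * k ^+ n.
  by rewrite mulrAC; exact: diff_lipschitz.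
pose D h := limn (series (fun n => 'd (f n) z h)).
have cD h : cvgn (series (fun n => 'd (f n) z h)).
  by have [] := geometric_dominated_series _ _ _ k01 (DA h).
have Dlin : linear D.
  move=> a h h'; rewrite /D -lim_seriesZ// -lim_seriesD//; last first.
    exact: is_cvg_seriesZ.
  by congr (limn (series _)); apply/funext => n; rewrite linearP.
pose DL : {linear V -> R} := HB.pack D (GRing.isLinear.Build _ _ _ _ D Dlin).
have Dc : continuous DL.
  apply: bounded_linear_continuous; apply/linear_boundedP.
  exists (A / (1 - k)); split; first exact: num_real.
  move=> r Ar h; apply: le_trans (geometric_dominated_series _ _ _ k01 (DA h)).2 _.
  by rewrite mulrAC ler_wpM2r// ltW.
apply: (@differentiable_of_linear _ _ DL) => // e e0.
pose r h n := f n (h + z) - f n z - 'd (f n) z h.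
have rA h n : `|r h n| <= 2 * A * `|h| * k ^+ n.
  apply: le_trans (ler_normB _ _) _.
  have := fA n (h + z); rewrite addrK; have := DA h n; lra.
have rE h : limn (series (f ^~ (h + z))) - limn (series (f ^~ z)) - D h =
    limn (series (r h)).
  have cB : cvgn (series (fun n => f n (h + z) - f n z)).
    have fB n : `|f n (h + z) - f n z| <= A * `|h| * k ^+ n.
      by have := fA n (h + z); rewrite addrK mulrAC.
    by have [] := geometric_dominated_series _ _ _ k01 fB.
  have -> : limn (series (f ^~ (h + z))) - limn (series (f ^~ z)) =
      limn (series (fun n => f n (h + z) - f n z)).
    rewrite -lim_seriesB//.
    have -> : f ^~ (h + z) = (fun n => f n (h + z) - f n z) + f ^~ z.
      by apply/funext => n; rewrite fctE subrK.
    exact: is_cvg_seriesD.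
  by rewrite /D -lim_seriesB.
have near_r M d : 0 < d -> \forall h \near (0 : V), `|series (r h) M| <= d * `|h|.
  elim: M d => [|M IH] d d0.
    by near=> h; rewrite /series/= big_geq// normr0 mulr_ge0// ltW.
  have d2 : 0 < d / 2 by rewrite divr_gt0.
  near=> h.
  have hM : `|series (r h) M| <= d / 2 * `|h| by near: h; exact: IH.
  have hr : `|r h M| <= d / 2 * `|h|.
    near: h.
    have /diff_locally /eqaddoP /(_ _ d2) := df M.
    by apply: filterS => h /=; rewrite fctE /= opprD addrA.
  rewrite seriesSr (le_trans (ler_normD _ _))//; lra.
(* The cut-off [M] depends on [e] only, since the bound [rA] is proportional to [|h|]; it is
   therefore fixed before [h] tends to 0. *)
have [M hM] : exists M, 2 * A * k ^+ M / (1 - k) <= e / 2.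
  have : (fun M => 2 * A / (1 - k) * k ^+ M) @ \oo --> (2 * A / (1 - k) * 0 : R).
    by apply: cvgMl_tmp; apply: cvg_expr; rewrite ger0_norm.
  rewrite mulr0 => /cvgrPdist_le /(_ (e / 2)) [|M _ /(_ M (leqnn _))]; first by rewrite divr_gt0.
  rewrite sub0r normrN => H; exists M; rewrite mulrAC (le_trans _ H)//.
  exact: ler_norm.
near=> h.
have h1 : `|series (r h) M| <= e / 2 * `|h|.
  by near: h; apply: near_r; rewrite divr_gt0.
have h2 := geometric_dominated_tail _ _ _ M k01 (rA h).
have h3 : 2 * A * `|h| * k ^+ M / (1 - k) <= e / 2 * `|h|.
  rewrite (_ : _ / _ = 2 * A * k ^+ M / (1 - k) * `|h|); last by ring.
  by rewrite ler_wpM2r.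
rewrite -[limn _ - limn _ - _]/(limn _ - limn _ - D h) rE.
rewrite -(subrK (series (r h) M) (limn _)) (le_trans (ler_normD _ _))//; lra.
Unshelve. all: by end_near. Qed.

End DifferentiableSeries.

(** * The sup norm of row vectors *)

Section RowNorm.
Context {R : realType}.

Lemma row_coord_le_norm n (v : 'rV[R]_n) i : `|v 0 i| <= `|v|.
Proof.
by rewrite [leRHS]/Num.norm /= mx_normrE; apply/bigmax_geP; right; exists (0, i).
Qed.

Lemma row_norm_le n (v : 'rV[R]_n) b : 0 <= b -> (forall i, `|v 0 i| <= b) -> `|v| <= b.
Proof.
move=> b0 vb; rewrite [leLHS]/Num.norm /= mx_normrE; apply/bigmax_leP; split=> // -[j i] _.
by rewrite ord1.
Qed.

End RowNorm.

(** * The bilateral lacunary sum: convergence, self-similarity, differentiability *)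

Section SelfSimilarSum.
Context {R : realType}.
Implicit Types (z w : 'rV[R]_2).

Definition reach z w : R := `|z 0 0| + dist1 z w.

Lemma reach_ge0 z w : 0 <= reach z w.
Proof. by rewrite addr_ge0// dist1_ge0. Qed.

Lemma reach_gt0 z w : z <> w -> 0 < reach z w.
Proof. by move=> /dist1_gt0 d0; rewrite /reach ltr_wpDl. Qed.

Lemma dist1_scale (t : R) z w : dist1 (t *: z) (t *: w) = `|t| * dist1 z w.
Proof. by rewrite /dist1 !mxE -!mulrBr !normrM mulrDr. Qed.

Lemma reach_scale (t : R) z w : reach (t *: z) (t *: w) = `|t| * reach z w.
Proof. by rewrite /reach dist1_scale !mxE normrM -mulrDr. Qed.

Lemma dist1xx z : dist1 z z = 0.
Proof. by rewrite /dist1 !subrr normr0 addr0. Qed.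

Lemma dist1_le_norm z w : dist1 z w <= 2 * `|w - z|.
Proof.
rewrite distrC /dist1.
have := row_coord_le_norm _ (z - w) 0; have := row_coord_le_norm _ (z - w) 1.
rewrite !mxE; lra.
Qed.

Variables (f : 'rV[R]_2 -> R) (L a k : R).
Hypothesis f_lipschitz : forall z w, `|f z - f w| <= dist1 z w.
Hypothesis f_decay : forall z w, `|f z - f w| * reach z w <= 6 * dist1 z w.
Hypothesis f_diff : forall z, differentiable f z.
Hypothesis a_gt0 : 0 < a.
Hypothesis L_gt0 : 0 < L.
Hypothesis k01 : 0 <= k < 1.
Hypothesis a_large : a^-1 <= k.
Hypothesis aL_small : a / L <= k.

(* The terms of index [n.+1] and [- n.+1] of the bilateral lacunary sum are paired,
   so that a series over [nat] suffices. *)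
Definition selfsim_term (n : nat) z : R :=
  a ^- n.+1 * (f (L ^+ n.+1 *: z) - f 0) + a ^+ n.+1 * (f (L ^- n.+1 *: z) - f 0).

Definition selfsim z : R := f z - f 0 + limn (series (selfsim_term ^~ z)).

Lemma f_decay_ratio z w : `|f z - f w| <= 6 * dist1 z w / reach z w.
Proof.
have [->|/eqP zw] := eqVneq z w; first by rewrite subrr normr0 dist1xx mulr0 mul0r.
by rewrite ler_pdivlMr ?reach_gt0.
Qed.

(** At the fine scales the decay estimate applies: [dist1 / reach] is invariant under dilation, so
    the coefficient [a^-(n+1)] alone gives [k^(n+1)]. At the coarse scales the Lipschitz estimate
    gives [(a / L)^(n+1)]. *)
Lemma selfsim_termB n z w : `|selfsim_term n z - selfsim_term n w| <=
  (6 * dist1 z w / reach z w + dist1 z w) * k * k ^+ n.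
Proof.
have -> : selfsim_term n z - selfsim_term n w =
    a ^- n.+1 * (f (L ^+ n.+1 *: z) - f (L ^+ n.+1 *: w)) +
    a ^+ n.+1 * (f (L ^- n.+1 *: z) - f (L ^- n.+1 *: w)).
  by rewrite /selfsim_term; ring.
have k0 : 0 <= k by have /andP[] := k01.
have Ln0 m : 0 < L ^+ m by exact: exprn_gt0.
have an0 m : 0 < a ^+ m by exact: exprn_gt0.
have d0 := dist1_ge0 z w; have S0 := reach_ge0 z w.
apply: le_trans (ler_normD _ _) _; rewrite !normrM.
rewrite -mulrA -exprS mulrDl lerD//.
  rewrite mulrC ler_pM//.
    apply: le_trans (f_decay_ratio _ _) _.
    rewrite dist1_scale reach_scale gtr0_norm// mulrCA -mulf_div divff ?mul1r//.
    by rewrite gt_eqF.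
  by rewrite gtr0_norm ?invr_gt0// -exprVn lerXn2r// nnegrE invr_ge0 ltW.
rewrite gtr0_norm//; apply: le_trans (ler_wpM2l (ltW (an0 _)) (f_lipschitz _ _)) _.
rewrite dist1_scale gtr0_norm ?invr_gt0// mulrA [leRHS]mulrC ler_wpM2r//.
by rewrite -expr_div_n lerXn2r// nnegrE divr_ge0// ltW.
Qed.

Lemma selfsim_term0 n : selfsim_term n 0 = 0.
Proof. by rewrite /selfsim_term !scaler0 subrr !mulr0 addr0. Qed.

Lemma cvg_selfsim_term z : cvgn (series (selfsim_term ^~ z)).
Proof.
have h n : `|selfsim_term n z| <=
    (6 * dist1 z 0 / reach z 0 + dist1 z 0) * k * k ^+ n.
  by have := selfsim_termB n z 0; rewrite selfsim_term0 subr0.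
by have [] := geometric_dominated_series _ _ _ k01 h.
Qed.

(** This makes precise that the central term dominates: where [reach] is bounded below, the other
    terms contribute a multiple of [dist1] that is small with [k]. *)
Lemma selfsimB z w : `|selfsim z - selfsim w - (f z - f w)| <=
  (6 * dist1 z w / reach z w + dist1 z w) * k / (1 - k).
Proof.
have [_] := geometric_dominated_series _ _ _ k01 (fun n => selfsim_termB n z w).
rewrite (lim_seriesB (cvg_selfsim_term z) (cvg_selfsim_term w)) => h.
have -> : selfsim z - selfsim w - (f z - f w) =
    limn (series (selfsim_term ^~ z)) - limn (series (selfsim_term ^~ w)).
  by rewrite /selfsim; ring.
exact: h.
Qed.

Lemma selfsim_scale z : selfsim (L *: z) = a * selfsim z.
Proof.
have a0 : a != 0 by rewrite gt_eqF.
have L0 : L != 0 by rewrite gt_eqF.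
pose F z := f z - f 0.
pose T n := a ^- n.+1 * F (L ^+ n.+1 *: z) - a ^+ n * F (L ^- n *: z).
have F_bounded (w : 'rV[R]_2) : `|F w| <= 6.
  apply: le_trans (f_decay_ratio _ _) _.
  have [->|/eqP w0] := eqVneq w 0; first by rewrite dist1xx mulr0 mul0r.
  rewrite ler_pdivrMr ?reach_gt0// ler_wpM2l// lerDr.
  by rewrite normr_ge0.
have F_lip (w : 'rV[R]_2) : `|F w| <= dist1 w 0 by exact: f_lipschitz.
have k0 : 0 <= k by have /andP[] := k01.
(* The first part of [T n] is a bounded value times [a^-(n+1)]; in the second, the Lipschitz bound
   turns [a^n] into [(a / L)^n]. *)
have T_geom n : `|T n| <= (6 + dist1 z 0) * k ^+ n.
  rewrite mulrDl (le_trans (ler_normB _ _))// !normrM lerD//.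
    rewrite mulrC ler_pM//.
    rewrite gtr0_norm ?invr_gt0 ?exprn_gt0// -exprVn.
    rewrite (@le_trans _ _ (k ^+ n.+1))//; first by rewrite lerXn2r// nnegrE ?invr_ge0 ltW.
    by rewrite exprS ler_piMl ?exprn_ge0// ltW//; have /andP[] := k01.
  rewrite gtr0_norm ?exprn_gt0//.
  apply: le_trans (ler_wpM2l _ (F_lip _)) _; first by rewrite exprn_ge0// ltW.
  rewrite -{1}(scaler0 _ (L ^- n)) dist1_scale gtr0_norm ?invr_gt0 ?exprn_gt0//.
  rewrite mulrA [leRHS]mulrC ler_wpM2r ?dist1_ge0//.
  by rewrite -expr_div_n lerXn2r// nnegrE divr_ge0// ltW.
(* Scaling by [L] shifts the bilateral sum by one index; on the paired series this
   changes the terms by a telescoping sequence. *)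
have cT : T @ \oo --> (0 : R).
  by apply: cvg_series_cvg_0; have [] := geometric_dominated_series _ _ _ k01 T_geom.
have e n : a^-1 * selfsim_term n (L *: z) = selfsim_term n z + telescope T n.
  rewrite /telescope /T /selfsim_term /F !scalerA -exprSr.
  rewrite [L ^- n.+1 * L](_ : _ = L ^- n); last by rewrite exprS; field; rewrite ?expf_neq0// L0.
  rewrite /= !(exprS a); field.
  by rewrite expf_neq0// a0.
have : a^-1 * limn (series (selfsim_term ^~ (L *: z))) =
    limn (series (selfsim_term ^~ z)) + (0 - T 0%N).
  rewrite -[a^-1 * _]/(a^-1 *: _) -lim_seriesZ; last exact: cvg_selfsim_term.
  have -> : a^-1 *: selfsim_term ^~ (L *: z) = selfsim_term ^~ z + telescope T.
    by apply/funext => n; exact: e.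
  have cTT : series (telescope T) @ \oo --> 0 - T 0%N.
    by rewrite telescopeK; apply: cvgB => //; exact: cvg_cst.
  rewrite lim_seriesD; [|exact: cvg_selfsim_term|exact: cvgP cTT].
  by rewrite (cvg_lim _ cTT).
rewrite /T/= expr1 expr0 invr1 mul1r !scale1r expr1 => h.
have := congr1 ( *%R a) h; rewrite mulrA mulfV// mul1r => {}h.
by rewrite /selfsim h /F; field.
Qed.

Lemma selfsim_scale_int (q : int) z : selfsim (L ^ q *: z) = a ^ q * selfsim z.
Proof.
have a0 : a != 0 by rewrite gt_eqF.
have L0 : L != 0 by rewrite gt_eqF.
have nat_case (n : nat) w : selfsim (L ^+ n *: w) = a ^+ n * selfsim w.
  elim: n w => [|n IH] w; first by rewrite !expr0 scale1r mul1r.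
  by rewrite exprSr -scalerA IH selfsim_scale mulrA -exprSr.
case: q => n; first exact: nat_case.
rewrite -[L ^ _]/(L ^- n.+1) -[a ^ _]/(a ^- n.+1).
apply: (mulfI (x := a ^+ n.+1)); first by rewrite expf_neq0.
rewrite -nat_case scalerA mulfV ?expf_neq0// scale1r.
by rewrite mulrA mulfV ?expf_neq0// mul1r.
Qed.

(** Off the axis, [reach z w >= |x| > 0] turns [selfsim_termB] into Lipschitz bounds at [z] with
    geometrically decaying constants, as [differentiable_series] requires. *)
Lemma differentiable_selfsim z : z 0 0 != 0 -> differentiable selfsim z.
Proof.
move=> z0.
have k0 : 0 <= k by have /andP[] := k01.
have dscale (c : R) : differentiable (fun w => f (c *: w) - f 0) z.
  apply: differentiableB => //; exact: (@differentiable_comp _ _ _ _ ( *:%R c) f).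
apply: differentiableD; first exact: differentiableB.
apply: (@differentiable_series _ _ _ _ ((6 / `|z 0 0| + 1) * 2 * k) k) => //.
- by move=> n; apply: differentiableD; apply: differentiableM.
- move=> n w; rewrite distrC (le_trans (selfsim_termB _ _ _))//.
  rewrite (_ : _ * `|w - z| = (6 / `|z 0 0| + 1) * (2 * `|w - z|) * k * k ^+ n); last by ring.
  rewrite ler_wpM2r ?exprn_ge0// ler_wpM2r//.
  have h : 6 * dist1 z w / reach z w + dist1 z w <= (6 / `|z 0 0| + 1) * dist1 z w.
    rewrite [leRHS]mulrDl mul1r lerD2r [leLHS]mulrAC ler_wpM2r ?dist1_ge0// ler_wpM2l//.
    by rewrite lef_pV2 ?posrE ?lerDl ?dist1_ge0// ?ltr_wpDr ?dist1_ge0// normr_gt0.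
  rewrite (le_trans h)// ler_wpM2l ?dist1_le_norm//.
- exact: cvg_selfsim_term.
Qed.

End SelfSimilarSum.

(** * The embedding and its two-sided distance estimate *)

Section Snowflake.
Context {R : realType}.
Implicit Types (z w : 'rV[R]_2).

(** The exponent is the integer part of the logarithm of [S] to base [L]. *)
Lemma int_power_bracket (L S : R) : 1 < L -> 0 < S ->
  exists q : int, L ^ q <= S < L ^ (q + 1).
Proof.
move=> L1 S0; have L0 : 0 < L by rewrite (lt_trans _ L1).
have lnL : 0 < ln L by rewrite ln_gt0.
have powE (q : int) : L ^ q = expR (q%:~R * ln L).
  by rewrite -powR_intmul ?ltW// /powR gt_eqF.
exists (Num.floor (ln S / ln L)); rewrite !powE.
rewrite -{2}[S]lnK// -{3}[S]lnK// ler_expR ltr_expR.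
rewrite -ler_pdivlMr// -ltr_pdivrMr//.
by rewrite floor_le_tmp floorD1_gt.
Qed.

Lemma ge0_ler_powR_npos (r x y : R) : r <= 0 -> 0 < x -> x <= y -> y `^ r <= x `^ r.
Proof.
move=> r0 x0 xy; have y0 : 0 < y by exact: lt_le_trans xy.
rewrite -[r]opprK !(powRN _ (- r)) lef_pV2 ?posrE ?powR_gt0//.
by rewrite ge0_ler_powR ?oppr_ge0// nnegrE ltW.
Qed.

Lemma powR_exprz (x s : R) (q : int) : 0 < x -> (x `^ s) ^ q = (x ^ q) `^ s.
Proof.
move=> x0.
by rewrite -(powR_intmul q (powR_ge0 x s)) -(powR_intmul q (ltW x0)) powRAC.
Qed.

Definition snow (s : R) z w : R := dist1 z w * reach z w `^ (s - 1).

Lemma snowxx s z : snow s z z = 0.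
Proof. by rewrite /snow dist1xx mul0r. Qed.

Section Fixed_ratio.
Variables (s : R) (K : nat).
Hypothesis s01 : 0 < s < 1.
Hypothesis K_s : 9 <= K%:R * s.
Hypothesis K_s1 : 9 <= K%:R * (1 - s).

Let L : R := 2 ^+ K.
Let a : R := L `^ s.
(** The hypotheses on [K] give [a >= 2^9] and [L / a >= 2^9]. With this [k] the error at reach at
    least 1/4 is at most [(6 * 4 + 1) / 511] times the distance, less than 1/16, hence at most half
    of the 1/8 granted by [profile_lower]. *)
Let k : R := 2 ^- 9.

Let s0 : 0 < s. Proof. by case/andP: s01. Qed.
Let s1 : s < 1. Proof. by case/andP: s01. Qed.
Let L0 : 0 < L. Proof. by rewrite exprn_gt0. Qed.
Let a0 : 0 < a. Proof. by rewrite powR_gt0. Qed.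
Let k0 : 0 < k. Proof. by rewrite invr_gt0 exprn_gt0. Qed.
Let k512 : 512 * k = 1. Proof. by rewrite /k -exprVn; field. Qed.
Let k01 : 0 <= k < 1.
Proof. by rewrite ltW//=; have := k512; have := k0; lra. Qed.

Let LE (r : R) : L `^ r = 2 `^ (K%:R * r).
Proof. by rewrite /L -powR_mulrn// -powRrM. Qed.

Let kE : k = 2 `^ (- 9).
Proof. by rewrite /k powR_invn. Qed.

Let a_large : a^-1 <= k.
Proof. by rewrite /a -powRN LE kE ler_powR ?ler1n// mulrN lerN2. Qed.

Let aL : a / L = L `^ (s - 1).
Proof. by rewrite /a -{2}(powRr1 (ltW L0)) -powRB// (gt_eqF L0) implybT. Qed.

Let aL_small : a / L <= k.
Proof. by rewrite aL LE kE ler_powR ?ler1n// -opprB mulrN lerN2. Qed.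

Let L1 : 1 < L.
Proof.
rewrite exprn_egt1 ?ltr1n//; apply/eqP => K0.
by move: K_s; rewrite K0 mul0r; lra.
Qed.

Local Notation H i := (selfsim (profile i) L a).

Let HB i z w := @selfsimB R (profile i) L a k (profile_lipschitz i)
  (profile_decay i) a0 L0 k01 a_large aL_small z w.

Let H_scale i q z := @selfsim_scale_int R (profile i) L a k (profile_lipschitz i)
  (profile_decay i) a0 L0 k01 a_large aL_small q z.

Let aLz (p : int) : a ^ p / L ^ p = (L ^ p) `^ (s - 1).
Proof.
have Lp0 : 0 < L ^ p by exact: exprz_gt0.
rewrite /a powR_exprz// -{2}(powRr1 (ltW Lp0)) -powRB//.
by rewrite (gt_eqF Lp0) implybT.
Qed.

Let ratioE : k / (1 - k) = 511^-1.
Proof.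
have -> : 1 - k = 511 * k by have := k512; lra.
by rewrite invfM mulrCA mulfV ?mulr1// gt_eqF.
Qed.

(** Dividing both points by a suitable power of [L] makes their reach at least [1 / L], where
    [selfsim] is Lipschitz; self-similarity carries the bound back. *)
Lemma selfsim_upper i z w : `|H i z - H i w| <= (6 * L + 2) * snow s z w.
Proof.
have [->|/eqP zw] := eqVneq z w; first by rewrite subrr normr0 snowxx mulr0.
have S0 := reach_gt0 _ _ zw.
have [q /andP[Sq qS]] := int_power_bracket _ _ L1 S0.
set p := q + 1 in qS *.
have Lp0 (j : int) : 0 < L ^ j by exact: exprz_gt0.
have ap0 (j : int) : 0 < a ^ j by exact: exprz_gt0.
pose Z := L ^ (- p) *: z; pose W := L ^ (- p) *: w.
have LNp : L ^ (- p) = (L ^ p)^-1 by rewrite invr_expz.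
have HE (v : 'rV[R]_2) : H i v = a ^ p * H i (L ^ (- p) *: v).
  by rewrite -H_scale scalerA LNp mulfV ?scale1r// gt_eqF.
rewrite (HE z) (HE w) -/Z -/W -mulrBr normrM (gtr0_norm (ap0 p)).
have dZ : dist1 Z W = (L ^ p)^-1 * dist1 z w by rewrite dist1_scale LNp gtr0_norm ?invr_gt0.
have SZ : L^-1 <= reach Z W.
  rewrite reach_scale LNp gtr0_norm ?invr_gt0// ler_pdivlMl//.
  by rewrite (le_trans _ Sq)// /p expfzDr ?gt_eqF// expr1z mulfK ?gt_eqF.
have d0 := dist1_ge0 Z W.
have HZW : `|H i Z - H i W| <= (6 * L + 2) * dist1 Z W.
  have := HB i Z W; have := profile_lipschitz i Z W.
  rewrite -mulrA ratioE.
  have : 6 * dist1 Z W / reach Z W <= 6 * dist1 Z W * L.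
    rewrite ler_wpM2l ?mulr_ge0// -[leRHS]invrK lef_pV2 ?posrE ?invr_gt0//.
    by rewrite (lt_le_trans _ SZ)// invr_gt0.
  have := ler_normD (H i Z - H i W - (profile i Z - profile i W))
    (profile i Z - profile i W).
  rewrite subrK; have := mulr_ge0 (ltW L0) d0; lra.
apply: le_trans (ler_wpM2l (ltW (ap0 p)) HZW) _.
rewrite dZ (_ : a ^ p * _ = (6 * L + 2) * (dist1 z w * (a ^ p / L ^ p))); last by ring.
(* The scaling factor is [(L^p)^(s-1)]; as [s - 1 < 0] and the reach is below [L^p], it is at most
   [reach^(s-1)]. *)
rewrite aLz /snow ler_wpM2l//; first by have := L0; lra.
rewrite ler_wpM2l ?dist1_ge0// ge0_ler_powR_npos ?subr_le0 ?(ltW s1)//.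
exact: ltW.
Qed.

(** A power of 2 brings the reach between 1/4 and 1/2, where [profile_lower] selects a component.
    That power is [L^q * 2^j] with [j < K]: self-similarity absorbs [L^q], and [2^j] remains as the
    dilation. *)
Lemma selfsim_lower z w : exists j i, [/\ (j < K)%N, (i < 3)%N &
  (4 * L) `^ (s - 1) / 16 * snow s z w <=
    `|H i (2 ^+ j *: z) - H i (2 ^+ j *: w)|].
Proof.
have Kp : (0 < K)%N by rewrite lt0n; apply/eqP => K0; move: K_s; rewrite K0 mul0r; lra.
have [->|/eqP zw] := eqVneq z w.
  by exists 0%N, 0%N; rewrite snowxx mulr0.
have S0 := reach_gt0 _ _ zw.
have two1 : 1 < 2 :> R by rewrite ltr1n.
have [q' /andP[Sq qS]] := int_power_bracket _ _ two1 S0.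
(* From [2^q' <= reach < 2^(q'+1)], the factor [2^m = 1 / (4 * 2^q')] puts the reach in the required
   range. *)
pose m := - (q' + 2).
pose q := (m %/ K)%Z; pose j := `|(m %% K)%Z|%N.
have jE : (m %% K)%Z = j by rewrite /j gez0_abs// modz_ge0// eqz_nat -lt0n.
have jK : (j < K)%N by rewrite -ltz_nat -jE ltz_pmod.
have p20 (n : int) : 0 < 2 ^ n :> R by exact: exprz_gt0.
have Lp0 (n : int) : 0 < L ^ n by exact: exprz_gt0.
have ap0 (n : int) : 0 < a ^ n by exact: exprz_gt0.
have mE : 2 ^ m = L ^ q * 2 ^+ j.
  rewrite {1}(divz_eq m K) expfzDr ?pnatr_eq0// jE mulrC.
  by rewrite -/q mulrC mulrC [(q * _)%R]mulrC -exprz_exp mulrC.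
have m2 : 2 ^ m = (2 ^ q' * 4)^-1 :> R.
  by rewrite /m -invr_expz expfzDr ?pnatr_eq0// -exprnP; congr ((_ * _)^-1); ring.
have mS : 4^-1 <= 2 ^ m * reach z w.
  by rewrite m2 ler_pdivlMl ?mulr_gt0// -mulrA divff// mulr1.
have mS2 : 2 ^ m * reach z w <= 2^-1.
  rewrite m2 ler_pdivrMl ?mulr_gt0//.
  by move: qS; rewrite expfzDr ?pnatr_eq0// expr1z; lra.
pose Z := 2 ^ m *: z; pose W := 2 ^ m *: w.
have dZ : dist1 Z W = 2 ^ m * dist1 z w by rewrite dist1_scale gtr0_norm.
have SZ : reach Z W = 2 ^ m * reach z w by rewrite reach_scale gtr0_norm.
have [i i3 fi] : exists2 i, (i < 3)%N & dist1 Z W / 8 <= `|profile i Z - profile i W|.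
  by apply: profile_lower; rewrite -/(reach Z W) SZ.
exists j, i; split=> //.
have HZW : dist1 Z W / 16 <= `|H i Z - H i W|.
  have d0 := dist1_ge0 Z W.
  have := HB i Z W; rewrite -mulrA ratioE distrC.
  have : 6 * dist1 Z W / reach Z W <= 6 * dist1 Z W * 4.
    rewrite ler_wpM2l ?mulr_ge0// -[leRHS]invrK lef_pV2 ?posrE ?SZ// ?mulr_gt0//.
  have := ler_normD (profile i Z - profile i W - (H i Z - H i W)) (H i Z - H i W).
  rewrite subrK; lra.
have HE (v : 'rV[R]_2) : H i (2 ^ m *: v) = a ^ q * H i (2 ^+ j *: v).
  by rewrite -H_scale scalerA -mE.
move: HZW; rewrite /Z /W !HE -mulrBr normrM (gtr0_norm (ap0 q)) => HZW.
rewrite -(ler_pM2l (ap0 q)) (le_trans _ HZW)// -/Z -/W dZ mE /snow.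
(* The three powers combine to [(4 * L * reach * L^q)^(s-1)]; the base is at least 1 because
   [2^j <= L], and the exponent is negative. *)
have key : (4 * L) `^ (s - 1) * reach z w `^ (s - 1) * (a ^ q / L ^ q) <= 1.
  rewrite aLz -!powRM ?mulr_ge0 ?(ltW L0) ?(ltW S0) ?(ltW (Lp0 q))//.
  apply: (@le_trans _ _ (1 `^ (s - 1))); last by rewrite powR1.
  rewrite ge0_ler_powR_npos ?subr_le0 ?(ltW s1)//.
  have : 4^-1 <= L ^ q * L * reach z w.
    apply: le_trans mS _; rewrite mE ler_wpM2r ?(ltW S0)// ler_wpM2l ?(ltW (Lp0 q))//.
    by rewrite ler_weXn2l ?ler1n// ltnW.
  lra.
have j1 : 1 <= 2 ^+ j :> R by rewrite exprn_ege1// ler1n.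
rewrite (_ : a ^ q * _ = ((4 * L) `^ (s - 1) * reach z w `^ (s - 1) * (a ^ q / L ^ q)) *
  (L ^ q * dist1 z w / 16)); last by field; rewrite gt_eqF.
rewrite (_ : L ^ q * _ * _ / 16 = 2 ^+ j * (L ^ q * dist1 z w / 16)); last by ring.
rewrite ler_wpM2r ?(le_trans key)//.
by rewrite divr_ge0// mulr_ge0 ?dist1_ge0// ltW.
Qed.

(** Coordinate [3 * j + i] is component [i] at dilation [2^j], so whichever pair [selfsim_lower]
    selects occurs as a coordinate. *)
Definition snowflake z : 'rV[R]_(3 * K) :=
  \row_(i < 3 * K) H (i %% 3)%N (2 ^+ (i %/ 3)%N *: z).

(** The dilation multiplies the distance by at most [L], and it enlarges the reach, whose negative
    power only drops. *)
Lemma snow_scale_le (j : nat) z w : (j < K)%N ->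
  snow s (2 ^+ j *: z) (2 ^+ j *: w) <= L * snow s z w.
Proof.
move=> jK; have [->|/eqP zw] := eqVneq z w; first by rewrite !snowxx mulr0.
have S0 := reach_gt0 _ _ zw.
have j1 : 1 <= 2 ^+ j :> R by rewrite exprn_ege1// ler1n.
rewrite /snow dist1_scale reach_scale ger0_norm ?exprn_ge0// mulrA.
rewrite ler_pM ?mulr_ge0 ?powR_ge0 ?dist1_ge0 ?exprn_ge0//.
  by rewrite ler_wpM2r ?dist1_ge0// ler_weXn2l ?ler1n// ltnW.
by rewrite ge0_ler_powR_npos ?subr_le0 ?(ltW s1)// ler_peMl// ltW.
Qed.

Lemma snowflake_le z w :
  `|snowflake z - snowflake w| <= (6 * L + 2) * L * snow s z w.
Proof.
have c0 : 0 <= 6 * L + 2 by have := L0; lra.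
apply: row_norm_le => [|i].
  by rewrite !mulr_ge0 ?powR_ge0 ?dist1_ge0// ltW.
rewrite !mxE (le_trans (selfsim_upper _ _ _))// -mulrA ler_wpM2l//.
by apply: snow_scale_le; rewrite ltn_divLR// [(K * 3)%N]mulnC.
Qed.

Lemma snowflake_ge z w :
  (4 * L) `^ (s - 1) / 16 * snow s z w <= `|snowflake z - snowflake w|.
Proof.
have [j [i [jK i3 h]]] := selfsim_lower z w.
apply: le_trans h _.
have ij : (3 * j + i < 3 * K)%N.
  by rewrite (@leq_trans (3 * j.+1))// ?leq_mul2l//= mulnS addnC ltn_add2r.
have := row_coord_le_norm _ (snowflake z - snowflake w) (Ordinal ij).
rewrite !mxE /=.
by rewrite (_ : (3 * j + i) %% 3 = i)%N 1?(_ : (3 * j + i) %/ 3 = j)%N//;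
  rewrite mulnC ?modnMDl ?modn_small ?divnMDl ?divn_small ?addn0.
Qed.

Lemma differentiable_snowflake z : z 0 0 != 0 -> differentiable snowflake z.
Proof.
move=> z0.
have -> : snowflake = \sum_(i < 3 * K)
    (fun z => H (i %% 3)%N (2 ^+ (i %/ 3)%N *: z) *: delta_mx 0 i : 'rV[R]_(3 * K)).
  apply/funext => w; rewrite fct_sumE [LHS]row_sum_delta.
  by apply: eq_bigr => i _; rewrite mxE.
apply: differentiable_sum => i; apply: differentiableZl.
apply: (@differentiable_comp _ _ _ _ ( *:%R (2 ^+ (i %/ 3)%N : R)) (H (i %% 3)%N)) => //.
apply: (@differentiable_selfsim R _ L a k) => //.
- exact: profile_lipschitz.
- exact: profile_decay.
- exact: differentiable_profile.
- by rewrite mxE mulf_neq0// expf_neq0// pnatr_eq0.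
Qed.

End Fixed_ratio.

Lemma snowflake_map (s : R) : 0 < s <= 1 ->
  exists (N : nat) (Phi : 'rV[R]_2 -> 'rV[R]_N) (c C : R),
    [/\ (0 < N)%N, 0 < c,
      forall z w, c * snow s z w <= `|Phi z - Phi w| <= C * snow s z w &
      forall z, z 0 0 != 0 -> differentiable Phi z].
Proof.
move=> /andP[s0]; rewrite le_eqVlt => /orP[/eqP ->|s1].
  (* For [s = 1] the identity works, and [snow] is the l1 distance, which lies between the sup norm
     and twice the sup norm. *)
  exists 2%N, id, 2^-1, 1; split=> // z w.
  rewrite /snow subrr powRr0 mulr1 mul1r; apply/andP; split.
    by rewrite ler_pdivrMl// distrC dist1_le_norm.
  apply: row_norm_le => [|i]; first exact: dist1_ge0.
  rewrite !mxE; case: i => [[|[|//]] i2].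
  - have -> : Ordinal i2 = 0 by exact: val_inj.
    by rewrite lerDl.
  - have -> : Ordinal i2 = 1 by exact: val_inj.
    by rewrite lerDr.
have [K [Ks Ks1]] : exists K : nat, 9 <= K%:R * s /\ 9 <= K%:R * (1 - s).
  have [K1 h1] : exists K : nat, 9 / s <= K%:R.
    by exists (Num.trunc (9 / s)).+1; rewrite ltW// truncnS_gt.
  have [K2 h2] : exists K : nat, 9 / (1 - s) <= K%:R.
    by exists (Num.trunc (9 / (1 - s))).+1; rewrite ltW// truncnS_gt.
  exists (maxn K1 K2); split.
    by rewrite -ler_pdivrMr// (le_trans h1)// ler_nat leq_maxl.
  by rewrite -ler_pdivrMr ?subr_gt0// (le_trans h2)// ler_nat leq_maxr.
exists (3 * K)%N, (snowflake s K).
exists ((4 * 2 ^+ K) `^ (s - 1) / 16), ((6 * 2 ^+ K + 2) * 2 ^+ K).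
have s01 : 0 < s < 1 by rewrite s0.
split.
- rewrite muln_gt0/= lt0n; apply/eqP => K0.
  by move: Ks; rewrite K0 mul0r; lra.
- by rewrite divr_gt0// powR_gt0// mulr_gt0// exprn_gt0.
- by move=> z w; rewrite snowflake_ge ?snowflake_le.
- by move=> z; exact: differentiable_snowflake.
Qed.

End Snowflake.

(** * Passage to Euclidean distances and quasisymmetry *)

Section EuclideanComparison.
Context {R : realType}.
Implicit Types (z w h : 'rV[R]_2) (t : R).

Lemma norm_le_euclidean n (u v : 'rV[R]_n) : `|u - v| <= euclidean_dist u v.
Proof.
apply: row_norm_le => [|i]; first exact: sqrtr_ge0.
rewrite !mxE -sqrtr_sqr ler_wsqrtr// (bigD1 i)//= lerDl sumr_ge0// => j _.
exact: sqr_ge0.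
Qed.

Lemma euclidean_le_norm n (u v : 'rV[R]_n) :
  euclidean_dist u v <= Num.sqrt n%:R * `|u - v|.
Proof.
rewrite -[`|u - v|]ger0_norm// -sqrtr_sqr -sqrtrM// ler_wsqrtr//.
rewrite (@le_trans _ _ (\sum_(i < n) `|u - v| ^+ 2))//; last first.
  by rewrite sumr_const card_ord mulr_natl.
apply: ler_sum => i _.
rewrite -[leLHS]real_normK ?num_real// ler_sqr ?nnegrE//.
by have := row_coord_le_norm _ (u - v) i; rewrite !mxE.
Qed.

Lemma euclidean_le_dist1 z w : euclidean_dist z w <= dist1 z w.
Proof.
rewrite -[dist1 z w]ger0_norm ?dist1_ge0// -sqrtr_sqr ler_wsqrtr//.
rewrite big_ord_recl big_ord_recl big_ord0 addr0 /dist1 [leRHS]sqrrD !real_normK ?num_real//.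
have -> : lift ord0 ord0 = 1 :> 'I_2 by exact: val_inj.
by rewrite addrAC lerDl mulrn_wge0// mulr_ge0.
Qed.

Lemma dist1_le_euclidean z w : dist1 z w <= 2 * euclidean_dist z w.
Proof.
apply: le_trans (dist1_le_norm z w) _.
by rewrite ler_wpM2l// distrC norm_le_euclidean.
Qed.

(** Let [t] be the ratio of distances. If [t >= 1], the reach grows and its negative power drops,
    leaving the factor [t]. If [t < 1], the reach shrinks at most by the factor [t], leaving
    [t * t^(s-1) = t^s]. *)
Lemma snow_ratio s (z1 z2 z3 : 'rV[R]_2) : 0 < s <= 1 -> z2 <> z1 -> z3 <> z1 ->
  snow s z1 z3 <= snow s z1 z2 *
    Num.max (dist1 z1 z3 / dist1 z1 z2) ((dist1 z1 z3 / dist1 z1 z2) `^ s).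
Proof.
move=> /andP[s0 s1] /nesym z12 /nesym z13.
have d2 := dist1_gt0 _ _ z12; have d3 := dist1_gt0 _ _ z13.
have S2 := reach_gt0 _ _ z12; have S3 := reach_gt0 _ _ z13.
set t := _ / dist1 z1 z2.
have t0 : 0 < t by rewrite divr_gt0.
have d3E : dist1 z1 z3 = t * dist1 z1 z2 by rewrite divfK// gt_eqF.
clearbody t; have s10 : s - 1 <= 0 by rewrite subr_le0.
rewrite /snow d3E.
have [t1|t1] := leP 1 t.
  rewrite [leRHS]mulrC (@le_trans _ _ (t * (dist1 z1 z2 * reach z1 z2 `^ (s - 1))))//.
    rewrite -mulrA ler_wpM2l ?(ltW t0)// ler_wpM2l ?(ltW d2)// ge0_ler_powR_npos//.
    by rewrite lerD2l d3E ler_peMl// ltW.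
  by rewrite ler_wpM2r ?mulr_ge0 ?powR_ge0 ?(ltW d2)// le_max lexx.
rewrite [leRHS]mulrC (@le_trans _ _ (t `^ s * (dist1 z1 z2 * reach z1 z2 `^ (s - 1))))//.
  rewrite -(mulr_powRB1 (ltW t0) s0) -!mulrA ler_wpM2l ?(ltW t0)//.
  rewrite [leRHS]mulrCA ler_wpM2l ?(ltW d2)// -powRM ?(ltW t0) ?(ltW S2)//.
  rewrite ge0_ler_powR_npos ?mulr_gt0// /reach mulrDr d3E lerD2r.
  by rewrite ler_piMl// ltW.
by rewrite ler_wpM2r ?mulr_ge0 ?powR_ge0 ?(ltW d2)// le_max lexx orbT.
Qed.

(** The maximum is [t^s] up to 1 and [t] from 1 on, so the inverse is the minimum of [v] and
    [v^(1/s)] at [v = u / M]. *)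
Lemma max_powR_homeo (s M : R) : 0 < s <= 1 -> 0 < M ->
  increasing_homeo_pos (fun t => M * Num.max t (t `^ s)).
Proof.
move=> /andP[s0 s1] M0; rewrite /increasing_homeo_pos.
have pos t : (t \in `]0, +oo[) = (0 < t) by rewrite in_itv/= andbT.
have cpow (r t : R) : 0 < t -> {for t, continuous (fun u => u `^ r)}.
  move=> t0; apply/differentiable_continuous/derivable1_diffP.
  by apply: derivable_powR; rewrite pos.
have cmax t : 0 < t -> {for t, continuous (fun u : R => M * Num.max u (u `^ s))}.
  move=> t0; apply: cvgMl_tmp.
  apply: (@continuous_max R R id (fun u => u `^ s) t); first exact: cvg_id.
  exact: cpow.
have cmin t : 0 < t ->
    {for t, continuous (fun u : R => Num.min (u / M) ((u / M) `^ s^-1))}.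
  move=> t0.
  have cd : {for t, continuous (fun u : R => u / M)} by apply: cvgMr_tmp; exact: cvg_id.
  apply: (@continuous_min R R (fun u => u / M) (fun u => (u / M) `^ s^-1) t cd).
  apply: (@continuous_comp R R R (fun u => u / M) (fun u => u `^ s^-1) t cd).
  by apply: cpow; rewrite divr_gt0.
have si1 : 1 <= s^-1 by rewrite invf_ge1.
have powK t : 0 < t -> (t `^ s) `^ s^-1 = t.
  by move=> t0; rewrite -powRrM mulfV ?gt_eqF// powRr1// ltW.
have powVK t : 0 < t -> (t `^ s^-1) `^ s = t.
  by move=> t0; rewrite -powRrM mulVf ?gt_eqF// powRr1// ltW.
split.
  move=> t u; rewrite !pos => t0 u0 tu; rewrite ltr_pM2l// gt_max !lt_max tu/=.
  by rewrite gt0_ltr_powR ?orbT// nnegrE ltW.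
exists (fun u => Num.min (u / M) ((u / M) `^ s^-1)); split.
- split=> t; rewrite !pos => t0.
    by rewrite mulr_gt0// lt_max t0.
  by rewrite lt_min powR_gt0 divr_gt0.
- move=> t; rewrite pos => t0; rewrite mulrAC mulfV ?gt_eqF// mul1r.
  have [t1|/ltW t1] := leP 1 t.
    by rewrite max_l ?ler1_powR// min_l// le1r_powR.
  by rewrite max_r ?ger1_powR ?t0// powK// min_r// ger1_powR ?t0.
- move=> u; rewrite pos => u0.
  have v0 : 0 < u / M by rewrite divr_gt0.
  have uE : M * (u / M) = u by rewrite mulrC divfK// gt_eqF.
  move: (u / M) v0 uE => v v0 <-; congr (_ * _).
  have [v1|/ltW v1] := leP 1 v.
    by rewrite min_l ?le1r_powR// max_l// ler1_powR.
  by rewrite min_r ?ge1r_powR ?v0// powVK// max_r// ge1r_powR ?v0.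
- by apply: continuous_in_subspaceT => t; rewrite inE/= in_itv/= andbT; exact: cmax.
- by apply: continuous_in_subspaceT => t; rewrite inE/= in_itv/= andbT; exact: cmin.
Qed.

(** The two-sided bound reduces the image ratio to a ratio of [snow] values, which [snow_ratio]
    controls; the dimension enters through the comparison of Euclidean and sup norms. *)
Lemma snow_quasisymmetric (s : R) N (Phi : 'rV[R]_2 -> 'rV[R]_N) (c C : R) :
    0 < s <= 1 -> 0 < c ->
    (forall z w, c * snow s z w <= `|Phi z - Phi w| <= C * snow s z w) ->
  @quasisymmetric R (euclidean R 2) (euclidean R N) Phi.
Proof.
move=> s01 c0 PhiE; have [s0 s1] := andP s01.
have snow0 z w : z <> w -> 0 < snow s z w.
  by move=> zw; rewrite mulr_gt0 ?dist1_gt0// powR_gt0// reach_gt0.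
have snow_ge0 z w : 0 <= snow s z w.
  by rewrite mulr_ge0 ?dist1_ge0// powR_ge0.
have C0 : 0 <= C.
  have zw : (0 : 'rV[R]_2) <> const_mx 1.
    by move=> /rowP /(_ 0); rewrite !mxE => /eqP; rewrite eq_sym oner_eq0.
  have /andP[_ h] := PhiE 0 (const_mx 1).
  by rewrite -(pmulr_lge0 _ (snow0 _ _ zw)) (le_trans _ h).
split.
  move=> z w Phizw; apply: contrapT => zw.
  have /andP[+ _] := PhiE z w.
  by rewrite Phizw subrr normr0 leNgt mulr_gt0// snow0.
(* The summand 1 makes [Q] positive, since only [0 <= C] has been derived. *)
pose Q := Num.sqrt N%:R * C / c + 1.
have Q0 : 0 < Q by rewrite ltr_wpDl// divr_ge0 ?(ltW c0)// mulr_ge0// sqrtr_ge0.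
exists (fun t => 2 * Q * Num.max t (t `^ s)); split.
  by apply: max_powR_homeo => //; rewrite mulr_gt0.
move=> z1 z2 z3 z21 z31.
pose t := @euclidean_dist R 2 z3 z1 / euclidean_dist z2 z1.
change (euclidean_dist (Phi z3) (Phi z1) / euclidean_dist (Phi z2) (Phi z1) <=
  2 * Q * Num.max t (t `^ s)).
have d2 := dist1_gt0 _ _ (nesym z21); have d3 := dist1_gt0 _ _ (nesym z31).
set tau := dist1 z1 z3 / dist1 z1 z2.
have E2 : 0 < euclidean_dist z2 z1.
  rewrite euclidean_dist_sym -(pmulr_rgt0 _ (ltr0n R 2)).
  exact: lt_le_trans d2 (dist1_le_euclidean _ _).
have taut : tau <= 2 * t.
  rewrite /tau /t ler_pdivrMr// -mulrA (le_trans (dist1_le_euclidean _ _))//.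
  rewrite ler_wpM2l// euclidean_dist_sym mulrAC ler_pdivlMr//.
  by rewrite ler_wpM2l ?sqrtr_ge0// euclidean_dist_sym euclidean_le_dist1.
have tau0 : 0 < tau by rewrite divr_gt0.
have t0 : 0 < t by lra.
(* Replacing the l1 ratio [tau] by the Euclidean ratio [t] costs a factor 2 in either branch,
   because [2^s <= 2]. *)
have maxE : Num.max tau (tau `^ s) <= 2 * Num.max t (t `^ s).
  rewrite ge_max (le_trans taut) ?ler_wpM2l ?le_max ?lexx//=.
  rewrite (@le_trans _ _ ((2 * t) `^ s))//.
    by apply: ge0_ler_powR; rewrite ?nnegrE ?(ltW s0) ?(ltW tau0)// ltW// mulr_gt0.
  rewrite powRM ?(ltW t0)// ler_pM ?powR_ge0 ?le_max ?lexx ?orbT//.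
  by rewrite ler1_powR// ler1n.
have up : euclidean_dist (Phi z3) (Phi z1) <= Num.sqrt N%:R * C * snow s z1 z3.
  rewrite euclidean_dist_sym (le_trans (euclidean_le_norm _ _ _))// -mulrA.
  by rewrite ler_wpM2l ?sqrtr_ge0//; have /andP[] := PhiE z1 z3.
have lo : c * snow s z1 z2 <= euclidean_dist (Phi z2) (Phi z1).
  rewrite euclidean_dist_sym (le_trans _ (norm_le_euclidean _ _ _))//.
  by have /andP[] := PhiE z1 z2.
have sn2 := snow0 _ _ (nesym z21).
have lo0 : 0 < euclidean_dist (Phi z2) (Phi z1).
  by rewrite (lt_le_trans _ lo)// mulr_gt0.
rewrite ler_pdivrMr// (le_trans up)//.
have m0 : 0 <= Num.max t (t `^ s) by rewrite le_max (ltW t0).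
rewrite (@le_trans _ _ (2 * Q * Num.max t (t `^ s) * (c * snow s z1 z2)))//; last first.
  by rewrite ler_wpM2l// !mulr_ge0 ?(ltW Q0).
have h := snow_ratio _ _ _ _ s01 z21 z31.
rewrite (@le_trans _ _ (Num.sqrt N%:R * C * (snow s z1 z2 * (2 * Num.max t (t `^ s)))))//.
  apply: ler_wpM2l; first by rewrite mulr_ge0// sqrtr_ge0.
  by rewrite (le_trans h)// ler_wpM2l ?snow_ge0.
rewrite [leRHS](_ : _ = (Q * c) * (snow s z1 z2 * (2 * Num.max t (t `^ s)))); last by ring.
rewrite ler_wpM2r//; first exact: mulr_ge0 (snow_ge0 _ _) (mulr_ge0 _ m0).
by rewrite /Q mulrDl divfK ?gt_eqF// mul1r lerDl ltW.
Qed.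

End EuclideanComparison.

(** * Jacobian bounds from bounds on the differential *)

Lemma det_mx22 (T : comNzRingType) (A : 'M[T]_2) :
  \det A = A 0 0 * A 1 1 - A 0 1 * A 1 0.
Proof.
rewrite (expand_det_row _ 0) !big_ord_recl big_ord0 addr0 /cofactor !det_mx11 !mxE /=.
rewrite expr0 expr1 mul1r mulN1r mulrN.
have l0 : lift ord0 (0 : 'I_1) = 1 :> 'I_2 by exact: val_inj.
have l1 : lift (lift ord0 ord0) (0 : 'I_1) = 0 :> 'I_2 by exact: val_inj.
have l2 : lift ord0 ord0 = 1 :> 'I_2 by exact: val_inj.
by rewrite ?l1 ?l0 ?l2.
Qed.

Section JacobianBounds.
Context {R : realType}.
Implicit Types (z w h : 'rV[R]_2).

(** The determinant is that of the Gram matrix [G] of the two rows of [J], and [E h] is the squared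
    Euclidean length of [h *m J]. The upper bound is [det <= G 0 0 * G 1 1]; the lower one evaluates
    [E] at a well-chosen [h]. *)
Lemma gram_bounds N (J : 'M[R]_(2, N)) (p q : R) : 0 < p ->
    (forall h, p * dist1 0 h <= `|h *m J| <= q * dist1 0 h) ->
  p ^+ 2 <= Num.sqrt (\det (J *m J^T)) <= N%:R * q ^+ 2.
Proof.
move=> p0 hJ.
pose G i j := \sum_k J i k * J j k.
have GE i j : (J *m J^T) i j = G i j.
  by rewrite mxE; apply: eq_bigr => k _; rewrite mxE.
pose E h := h 0 0 ^+ 2 * G 0 0 + 2 * h 0 0 * h 0 1 * G 0 1 + h 0 1 ^+ 2 * G 1 1.
have EE h : E h = \sum_k (h *m J) 0 k ^+ 2.
  rewrite /E /G !mulr_sumr -!big_split; apply: eq_bigr => k _ /=.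
  rewrite mxE big_ord_recl big_ord_recl big_ord0 addr0.
  have -> : lift ord0 ord0 = 1 :> 'I_2 by exact: val_inj.
  by ring.
have d0 (h : 'rV[R]_2) : dist1 0 h = `|h 0 0| + `|h 0 1|.
  by rewrite /dist1 !mxE !sub0r !normrN.
have lo h : (p * dist1 0 h) ^+ 2 <= E h.
  have E0 : 0 <= E h by rewrite EE sumr_ge0// => k _; exact: sqr_ge0.
  rewrite -(sqr_sqrtr E0) ler_sqr ?nnegrE ?sqrtr_ge0 ?mulr_ge0 ?dist1_ge0 ?(ltW p0)//.
  have /andP[h1 _] := hJ h; apply: le_trans h1 _.
  have := norm_le_euclidean _ (h *m J) 0; rewrite subr0 EE /euclidean_dist.
  by under eq_bigr do rewrite [X in _ - X]mxE subr0.
have up h : E h <= N%:R * (q * dist1 0 h) ^+ 2.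
  rewrite EE; apply: (@le_trans _ _ (\sum_(k < N) (q * dist1 0 h) ^+ 2)).
    apply: ler_sum => k _; have /andP[h0 h1] := hJ h.
    rewrite -[leLHS]real_normK ?num_real// ler_sqr ?nnegrE//.
      exact: le_trans (row_coord_le_norm _ _ _) h1.
    exact: le_trans h1.
  by rewrite sumr_const card_ord mulr_natl.
pose e0 : 'rV[R]_2 := delta_mx 0 0; pose e1 : 'rV[R]_2 := delta_mx 0 1.
have detE : \det (J *m J^T) = G 0 0 * G 1 1 - G 0 1 ^+ 2.
  rewrite det_mx22 !GE expr2; congr (_ - _ * _).
  by apply: eq_bigr => k _; rewrite mulrC.
have Ee0 : E e0 = G 0 0 by rewrite /E !mxE /=; ring.
have Ee1 : E e1 = G 1 1 by rewrite /E !mxE /=; ring.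
have de0 : dist1 0 e0 = 1 by rewrite d0 !mxE /= normr1 normr0 addr0.
have de1 : dist1 0 e1 = 1 by rewrite d0 !mxE /= normr1 normr0 add0r.
have := lo e0; have := up e0; have := up e1.
rewrite Ee0 Ee1 de0 de1 !mulr1 => u1 u0 l0.
have G00 : 0 < G 0 0 by rewrite (lt_le_trans _ l0)// exprn_gt0.
have G11 : 0 <= G 1 1 by apply: sumr_ge0 => k _; rewrite -expr2 sqr_ge0.
have pp : 0 <= p ^+ 2 by exact: sqr_ge0.
have Nq : 0 <= N%:R * q ^+ 2 by rewrite mulr_ge0// sqr_ge0.
apply/andP; split.
  rewrite -[p ^+ 2]ger0_norm// -sqrtr_sqr ler_wsqrtr// detE.
  (* With this [h], [h *m J] is the second row minus its projection on the first, so [E h] is the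
     determinant divided by [G 0 0]. *)
  pose h : 'rV[R]_2 := \row_j (if j == 0 then - (G 0 1 / G 0 0) else 1).
  have := lo h.
  have h1 : 1 <= dist1 0 h by rewrite d0 !mxE /= normr1 lerDr.
  have -> : E h = (G 0 0 * G 1 1 - G 0 1 ^+ 2) / G 0 0.
    by rewrite /E !mxE /=; field; rewrite gt_eqF.
  rewrite ler_pdivlMr// => hE; apply: le_trans hE.
  rewrite expr2 ler_pM// exprMn ler_peMr// exprn_ege1//.
rewrite -[leRHS]ger0_norm// -sqrtr_sqr ler_wsqrtr// detE.
rewrite (@le_trans _ _ (G 0 0 * G 1 1))//; first by rewrite gerBl sqr_ge0.
by rewrite expr2 ler_pM// ltW.
Qed.

(** For small [t] the reach from [z] to [z + t h] lies between [|x|] and [2 |x|], which bounds the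
    difference quotients; the bounds pass to the limit. *)
Lemma diff_snow_bounds (s : R) N (Phi : 'rV[R]_2 -> 'rV[R]_N) (c C : R) z h :
    s <= 1 -> 0 <= c -> 0 <= C ->
    (forall w, c * snow s z w <= `|Phi z - Phi w| <= C * snow s z w) ->
    z 0 0 != 0 -> differentiable Phi z ->
  c * (2 * `|z 0 0|) `^ (s - 1) * dist1 0 h <= `|'d Phi z h| <=
    C * `|z 0 0| `^ (s - 1) * dist1 0 h.
Proof.
move=> s1 c0 C0 PhiE z0 dPhi.
have s10 : s - 1 <= 0 by rewrite subr_le0.
have x0 : 0 < `|z 0 0| by rewrite normr_gt0.
have dE (t : R) : dist1 z (t *: h + z) = `|t| * dist1 0 h.
  rewrite /dist1 !mxE !sub0r !normrN ![_ + z 0 _]addrC !opprD !addrA !subrr !sub0r.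
  by rewrite !normrN !normrM mulrDr.
have quotE (t : R) : `|t^-1 *: (Phi (t *: h + z) - Phi z)| =
    `|t|^-1 * `|Phi z - Phi (t *: h + z)| by rewrite normrZ normfV distrC.
apply/andP; split.
- apply: diff_norm_ge => //.
  (* Adding 1 gives a positive divisor even when [h = 0]. *)
  have n1 : 0 < dist1 0 h + 1 by rewrite ltr_wpDl// dist1_ge0.
  near=> t.
  have t0 : t != 0 by near: t; exact: nbhs_dnbhs_neq.
  have tx : `|t| * dist1 0 h <= `|z 0 0|.
    rewrite (@le_trans _ _ (`|t| * (dist1 0 h + 1)))//; first by rewrite ler_wpM2l// lerDl.
    rewrite -ler_pdivlMr// ltW//.
    by near: t; apply: dnbhs0_lt; rewrite divr_gt0.
  rewrite quotE ler_pdivlMl ?normr_gt0//.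
  have /andP[+ _] := PhiE (t *: h + z); apply: le_trans.
  rewrite /snow dE mulrCA -!mulrA ler_wpM2l// mulrCA ler_wpM2l//.
  rewrite mulrC ler_wpM2l ?dist1_ge0// ge0_ler_powR_npos//.
    by rewrite ltr_wpDr// dist1_ge0.
  by rewrite /reach dE mulr2n mulrDl mul1r lerD2l.
- apply: diff_norm_le => //.
  near=> t.
  have t0 : t != 0 by near: t; exact: nbhs_dnbhs_neq.
  rewrite quotE ler_pdivrMl ?normr_gt0//.
  have /andP[_ ] := PhiE (t *: h + z); move=> /le_trans; apply.
  rewrite /snow dE mulrCA -!mulrA ler_wpM2l// mulrCA ler_wpM2l//.
  rewrite [leRHS]mulrC ler_wpM2l ?dist1_ge0// ge0_ler_powR_npos//.
  by rewrite lerDl dist1_ge0.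
Unshelve. all: by end_near. Qed.

(** The exceptional set lies in the vertical axis, of product measure [0 * +oo = 0]. *)
Lemma ae_plane_fst_neq0 (Q : 'rV[R]_2 -> Prop) :
  (forall z, z 0 0 != 0 -> Q z) -> ae_plane Q.
Proof.
move=> HQ; exists ([set 0] `*` setT); split.
- exact: measurableX.
- rewrite product_measure1E//.
  by rewrite [X in (X * _)%E](lebesgue_measure_set1 0) mul0e.
- move=> -[x y] /= nQ; split => //=; apply: contrapT => /eqP x0.
  by apply: nQ; apply: HQ; rewrite mxE.
Qed.

End JacobianBounds.

Theorem theorem19 (R : realType) (beta : R) (hbeta : -2 < beta <= 0) :
  exists (N : nat) (Phi : 'rV[R]_2 -> 'rV[R]_N),
    [/\ (0 < N)%N,
        @quasisymmetric R (euclidean R 2) (euclidean R N) Phi,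
        ae_plane (fun z => differentiable Phi z) &
        exists C : R, 1 <= C /\
          ae_plane (fun z =>
            C^-1 * `|z 0 0| `^ beta <= jacobian_factor Phi z
              <= C * `|z 0 0| `^ beta)].
Proof.
have /andP[b2 b0] := hbeta.
pose s := 1 + beta / 2.
have s01 : 0 < s <= 1 by rewrite /s; apply/andP; split; lra.
have [_ s1] := andP s01.
have [N [Phi [c [C [N0 c0 PhiE dPhi]]]]] := snowflake_map _ s01.
exists N, Phi; split => //.
- exact: snow_quasisymmetric s01 c0 PhiE.
- exact: ae_plane_fst_neq0.
(* The power of 2 comes from the base [2 |x|] in the lower bound of [diff_snow_bounds]. *)
pose p := c * 2 `^ (s - 1).
have p0 : 0 < p by rewrite mulr_gt0// powR_gt0.
have C0 : 0 <= C.
  have /andP[h1 h2] := PhiE 0 (const_mx 1).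
  have : 0 < snow s 0 (const_mx 1 : 'rV[R]_2).
    rewrite mulr_gt0 ?powR_gt0 ?reach_gt0 ?dist1_gt0//;
      by move=> /rowP /(_ 0); rewrite !mxE => /eqP; rewrite eq_sym oner_eq0.
  by move=> sn; rewrite -(pmulr_lge0 _ sn) (le_trans _ h2).
(* The sum dominates 1, the upper constant [N * C^2] and the inverse of the lower constant [p^2] at
   once. *)
pose M := 1 + N%:R * C ^+ 2 + (p ^+ 2)^-1.
have NC : 0 <= N%:R * C ^+ 2 by rewrite mulr_ge0// sqr_ge0.
have pV : 0 < (p ^+ 2)^-1 by rewrite invr_gt0 exprn_gt0.
exists M; split; first by rewrite /M; lra.
apply: ae_plane_fst_neq0 => z z0.
have x0 : 0 < `|z 0 0| by rewrite normr_gt0.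
have lamE : (`|z 0 0| `^ (s - 1)) ^+ 2 = `|z 0 0| `^ beta.
  by rewrite -powR_mulrn ?powR_ge0// -powRrM; congr (_ `^ _); rewrite /s; field.
set lam := `|z 0 0| `^ (s - 1) in lamE.
have lam0 : 0 < lam by rewrite powR_gt0.
have /gram_bounds : forall h, p * lam * dist1 0 h <= `|h *m 'J Phi z| <= C * lam * dist1 0 h.
  move=> h; rewrite /jacobian mul_rV_lin1.
  have := diff_snow_bounds s N Phi c C z h s1 (ltW c0) C0 (PhiE z) z0 (dPhi z z0).
  by rewrite powRM// mulrA.
move=> /(_ (mulr_gt0 p0 lam0)) /andP[lo up].
rewrite /jacobian_factor -lamE; apply/andP; split.
  rewrite (le_trans _ lo)// exprMn ler_wpM2r ?sqr_ge0//.
  rewrite -[leRHS]invrK lef_pV2 ?posrE// /M; lra.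
rewrite (le_trans up)// exprMn mulrA ler_wpM2r ?sqr_ge0// /M; lra.
Qed.
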